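(* Let $\mathsf{Ag}=\{a,b\}$, $G=\{a,b\}$, and let $\mathcal{G}_3$, $\chi$ and $\rho$ be as described in the context. Let $\mathrm{I}$ be an information perspective in which agent $a$'s strategy is common knowledge among $G$. Then $\mathcal{G}_3,(\chi,\mathrm{I},\rho)\Vdash\mathsf{C}_Gp$.
   Context: Fix a countable set $\mathsf{Prop}$ of atomic propositions containing $p,q$, and the set of agents $\mathsf{Ag}=\{a,b\}$. A concurrent game structure is a tuple $\mathcal{G}=(\mathsf{Ac},\mathsf{V},\mathsf{E},\ell,(\sim_c)_{c\in\mathsf{Ag}})$ where $\mathsf{Ac}$ is a finite set of actions, $\mathsf{V}$ a finite set of positions, $\mathsf{E}:\mathsf{V}\times\mathsf{Ac}^{\mathsf{Ag}}\to\mathsf{V}$ a transition function, $\ell:\mathsf{V}\to\mathcal{P}(\mathsf{Prop})$ a valuation, and each $\sim_c\subseteq(\mathsf{V}\times\mathsf{V})\cup(\mathsf{Ac}\times\mathsf{Ac})$ an equivalence relation. A joint action is a function $\gamma:\mathsf{Ag}\to\mathsf{Ac}$; $\gamma\sim_c\delta$ iff $\gamma(d)\sim_c\delta(d)$ for all $d$. A history is a sequence $\rho=v_0\gamma_1v_1\ldots\gamma_nv_n$ of positions and joint actions with $\mathsf{E}(v_i,\gamma_{i+1})=v_{i+1}$; $\rho_{\le i}=v_0\gamma_1\ldots\gamma_iv_i$, $\mathsf{last}(\rho)=v_n$; $\mathsf{Hist}$ is the set of histories. $\rho\sim_c\rho'$ iff they have the same number $n$ of joint actions, their $i$-th positions are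 $\sim_c$-related ($i\le n$) and their $i$-th joint actions are $\sim_c$-related ($1\le i\le n$). A strategy is a function $\mathsf{Hist}\to\mathsf{Ac}$; an assignment is a function from $\mathsf{Ag}$ to strategies. $\rho$ is consistent with $\chi$ for $X\subseteq\mathsf{Ag}$ if $\gamma_{i+1}(d)=\chi(d)(\rho_{\le i})$ for all $i<n$, $d\in X$. The one-step continuation is $\mathsf{X}^\chi_{\mathcal G}\rho=\rho\,\gamma_{n+1}v_{n+1}$ with $\gamma_{n+1}(d)=\chi(d)(\rho)$ and $v_{n+1}=\mathsf{E}(v_n,\gamma_{n+1})$. $\mathsf{Ag}^*$ is the set of finite words over $\mathsf{Ag}$ with no two equal adjacent letters; $\mathsf{Ag}^{\ge n}$ those of length $\ge n$, and similarly $G^{\ge n}$ for words over $G$; $cw$ denotes $w$ prefixed by $c$. An information perspective is a set $\mathrm{I}\subseteq\mathsf{Ag}^{\ge2}$; $\mathrm{I}_c=\{d: cd\in\mathrm{I}\}\cup\{c\}$; $\mathrm{I}[c]=\{w\in\mathsf{Ag}^{\ge2}: cw\in\mathrm{I}\}\cup\{w\in\mathrm{I}: w=cw'\text{ for some }w'\in\mathsf{Ag}^*\}$. Agent $a$'s strategy is common knowledge among $G$ in $\mathrm{I}$ if $wa\in\mathrm{I}$ for every $w\in G^{\ge1}$ such that $wa$ has no two equal adjacent letters (i.e. $ba,aba,baba,\ldots\in\mathrm{I}$). $\chi\sim^{\mathrm{I}}_c\chi'$ iff $\chi(d)=\chi'(d)$ for all $d\in\mathrm{I}_c$. A state is a triple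 $(\chi,\mathrm{I},\rho)$; it is $c$-consistent if $\rho$ is consistent with $\chi$ for $\mathrm{I}_c$. $(\chi,\mathrm{I},\rho)\trianglelefteq_c(\chi',\mathrm{I}',\rho')$ iff $\chi\sim^{\mathrm{I}}_c\chi'$, $\mathrm{I}[c]\subseteq\mathrm{I}'$, $\rho\sim_c\rho'$, and both states are $c$-consistent. $Z\trianglelefteq_GZ'$ iff $Z\trianglelefteq_cZ'$ for some $c\in G$; $\trianglelefteq^*_G$ is its transitive closure. Truth: $\mathcal{G},(\chi,\mathrm{I},\rho)\Vdash p$ iff $p\in\ell(\mathsf{last}(\rho))$; $\mathcal{G},Z\Vdash\mathsf{C}_G\phi$ iff $\mathcal{G},Z'\Vdash\phi$ for all $Z'$ with $Z\trianglelefteq^*_GZ'$. The structure $\mathcal{G}_3$: positions $v_1,v_2,v_3$; actions $\mathsf{Ac}=\{\alpha,\beta\}$; $\mathsf{E}(v_1,\gamma)=v_2$ if $\gamma(a)=\alpha$ and $=v_3$ if $\gamma(a)=\beta$; $\mathsf{E}(v_2,\gamma)=v_2$, $\mathsf{E}(v_3,\gamma)=v_3$ for all $\gamma$; $\ell(v_1)=\emptyset$, $\ell(v_2)=\{p\}$, $\ell(v_3)=\{q\}$. Agent $a$ distinguishes all positions and both actions ($\sim_a$ is equality); for agent $b$, $v_2\sim_bv_3$ and $\alpha\sim_b\beta$, while $v_1$ is $\sim_b$-related only to itself. $\chi$ is an assignment with $\chi(a)(v_1)=\alpha$ (here $v_1$ is the history of length zero), and $\rho=v_1\gamma_1v_2$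 where $\gamma_1(a)=\alpha$ and $\gamma_1(b)=\chi(b)(v_1)$. *)

(* Defs.v *)
From HB Require Import structures.
From Stdlib Require Import Relation_Operators.
From mathcomp Require Import all_boot.

Set Implicit Arguments.
Unset Strict Implicit.
Unset Printing Implicit Defensive.

Inductive agent := ag_a | ag_b.

Definition agent_to_bool (c : agent) : bool := if c is ag_a then true else false.
Definition agent_of_bool (x : bool) : agent := if x then ag_a else ag_b.

Lemma agent_to_boolK : cancel agent_to_bool agent_of_bool.
Proof. by case. Qed.

HB.instance Definition _ := Finite.copy agent (can_type agent_to_boolK).

(* A relation on the disjoint union of positions and actions contained in
   (V x V) u (Ac x Ac) is given by its two halves. *)
Record cgs (Prp : countType) := Cgs {
  Ac : finType;
  V : finType;
  E : V -> {ffun agent -> Ac} -> V;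
  val_at : V -> Prp -> Prop;
  simV : agent -> rel V;
  simAc : agent -> rel Ac;
  simV_equiv : forall c, equivalence_rel (simV c);
  simAc_equiv : forall c, equivalence_rel (simAc c) }.

Section Game.

Variables (Prp : countType) (GS : cgs Prp).

Definition jaction : Type := {ffun agent -> Ac GS}.

Definition jact_sim (c : agent) (g g' : jaction) : bool :=
  [forall d, simAc c (g d) (g' d)].

Fixpoint steps_ok (v : V GS) (s : seq (jaction * V GS)) : bool :=
  if s is (g, v') :: s' then (E v g == v') && steps_ok v' s' else true.

Lemma steps_ok_take v s i : steps_ok v s -> steps_ok v (take i s).
Proof.
elim: s v i => [|[g v'] s IHs] v [|i] //= /andP[-> s_ok] /=.
exact: IHs.
Qed.

(* v0 g1 v1 ... gn vn is encoded as v0 together with (g1, v1), ..., (gn, vn) *)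
Record history := History {
  hstart : V GS;
  hsteps : seq (jaction * V GS);
  hsteps_ok : steps_ok hstart hsteps }.

Definition hpositions (h : history) : seq (V GS) :=
  hstart h :: unzip2 (hsteps h).

Definition hactions (h : history) : seq jaction := unzip1 (hsteps h).

Definition hlast (h : history) : V GS := last (hstart h) (unzip2 (hsteps h)).

Definition hist0 (v : V GS) : history := @History v [::] isT.

Definition hprefix (h : history) (i : nat) : history :=
  History (steps_ok_take i (hsteps_ok h)).

(* all2 also requires both sequences to have the same length *)
Definition hist_sim (c : agent) (h h' : history) : bool :=
  all2 (simV c) (hpositions h) (hpositions h')
  && all2 (jact_sim c) (hactions h) (hactions h').

Definition strategy : Type := history -> Ac GS.

Definition assignment : Type := agent -> strategy.

(* The ordinal i counts from 0, so item i of hactions h is the (i+1)-st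
   joint action. *)
Definition consistent (h : history) (chi : assignment) (X : agent -> Prop) :
    Prop :=
  forall (i : 'I_(size (hactions h))) (d : agent),
    X d -> tnth (in_tuple (hactions h)) i d = chi d (hprefix h i).

End Game.

Definition nostutter (w : seq agent) : bool := sorted (fun c d => c != d) w.

(* words G n is G^{>= n}; words setT n is Ag^{>= n} *)
Definition words (G : {set agent}) (n : nat) (w : seq agent) : bool :=
  [&& nostutter w, all (mem G) w & n <= size w].

Record perspective := Perspective {
  in_persp :> seq agent -> Prop;
  in_perspP : forall w, in_persp w -> words setT 2 w }.

Definition persp_agents (I : perspective) (c d : agent) : Prop :=
  I [:: c; d] \/ d = c.

Definition persp_after_pred (I : perspective) (c : agent) (w : seq agent) :
    Prop :=
  (words setT 2 w /\ I (c :: w))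
  \/ (I w /\ exists2 w', words setT 0 w' & w = c :: w').

Lemma persp_after_subproof I c w : persp_after_pred I c w -> words setT 2 w.
Proof. by case=> [[]|[/in_perspP]]. Qed.

(* I[c] *)
Definition persp_after (I : perspective) (c : agent) : perspective :=
  Perspective (@persp_after_subproof I c).

Definition strategy_common (I : perspective) (G : {set agent}) (c : agent) :
    Prop :=
  forall w, words G 1 w -> nostutter (rcons w c) -> I (rcons w c).

Section Semantics.

Variables (Prp : countType) (GS : cgs Prp).

(* Strategies are compared extensionally, as set-theoretic functions. *)
Definition assign_sim (I : perspective) (c : agent)
    (chi chi' : assignment GS) : Prop :=
  forall d, persp_agents I c d -> chi d =1 chi' d.

Record state := State {
  st_assign : assignment GS;
  st_persp : perspective;
  st_hist : history GS }.

Definition st_consistent (c : agent) (Z : state) : Prop :=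
  consistent (st_hist Z) (st_assign Z) (persp_agents (st_persp Z) c).

Definition st_acc (c : agent) (Z Z' : state) : Prop :=
  [/\ assign_sim (st_persp Z) c (st_assign Z) (st_assign Z'),
      forall w, persp_after (st_persp Z) c w -> st_persp Z' w,
      hist_sim c (st_hist Z) (st_hist Z'),
      st_consistent c Z
    & st_consistent c Z'].

Definition st_accG (G : {set agent}) (Z Z' : state) : Prop :=
  exists2 c, c \in G & st_acc c Z Z'.

End Semantics.

Inductive formula (Prp : Type) :=
  | Atom of Prp
  | Common of {set agent} & formula Prp.

(* clos_trans is the transitive closure, not the reflexive transitive one *)
Fixpoint forces (Prp : countType) (GS : cgs Prp) (Z : state GS)
    (phi : formula Prp) : Prop :=
  match phi with
  | Atom x => val_at (hlast (st_hist Z)) x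
  | Common G psi =>
      forall Z', clos_trans (state GS) (st_accG G) Z Z' -> forces Z' psi
  end.

Inductive action3 := alpha | beta.

Definition action3_to_bool (x : action3) : bool :=
  if x is alpha then true else false.
Definition action3_of_bool (x : bool) : action3 := if x then alpha else beta.

Lemma action3_to_boolK : cancel action3_to_bool action3_of_bool.
Proof. by case. Qed.

HB.instance Definition _ := Finite.copy action3 (can_type action3_to_boolK).

Inductive position3 := v1 | v2 | v3.

Definition position3_to_opt (x : position3) : option bool :=
  match x with v1 => None | v2 => Some true | v3 => Some false end.
Definition position3_of_opt (x : option bool) : position3 :=
  match x with None => v1 | Some true => v2 | Some false => v3 end.

Lemma position3_to_optK : cancel position3_to_opt position3_of_opt.
Proof. by case. Qed.

HB.instance Definition _ :=
  Finite.copy position3 (can_type position3_to_optK).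

Definition E3 (v : position3) (g : {ffun agent -> action3}) : position3 :=
  match v with
  | v1 => match g ag_a with alpha => v2 | beta => v3 end
  | v2 => v2
  | v3 => v3
  end.

Definition val3 (Prp : Type) (p q : Prp) (v : position3) (x : Prp) : Prop :=
  match v with v1 => False | v2 => x = p | v3 => x = q end.

Definition simV3 (c : agent) (v v' : position3) : bool :=
  match c with
  | ag_a => v == v'
  | ag_b => (v == v1) == (v' == v1)
  end.

Definition simAc3 (c : agent) (x y : action3) : bool :=
  match c with ag_a => x == y | ag_b => true end.

Lemma simV3_equiv c : equivalence_rel (simV3 c).
Proof. by case: c => [] [] [] []. Qed.

Lemma simAc3_equiv c : equivalence_rel (simAc3 c).
Proof. by case: c => [] [] [] []. Qed.

Definition G3 (Prp : countType) (p q : Prp) : cgs Prp :=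
  @Cgs Prp action3 position3 E3 (val3 p q) simV3 simAc3
    simV3_equiv simAc3_equiv.

(* Main.v *)
Require Import Defs.
From mathcomp Require Import all_boot.

(** Common knowledge of a strategy survives the passage from [I] to [I[c]], so
    along every accessibility chain both agents keep knowing [a]'s strategy.
    They therefore agree on its value [alpha] at the initial history, and
    consistency then forces any indistinguishable one-step history from [v1]
    to end in [v2]. *)

Set Implicit Arguments.
Unset Strict Implicit.
Unset Printing Implicit Defensive.

(** If a word over [G] starts with [c], its extension by [d] lies in [I] and so in [I[c]]; otherwise
    [c] can be prefixed, and the longer word is still over [G]. *)
Lemma strategy_common_after (I : perspective) (G : {set agent}) (c d : agent) :
  c \in G -> strategy_common I G d -> strategy_common (persp_after I c) G d.
Proof.
move=> cG I_d [|e w] // ew_word ewd.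
case: (eqVneq c e) => [->|ce]; [right|left].
  split; first exact: I_d.
  exists (rcons w d); rewrite // /words andbT; apply/andP; split.
    exact: path_sorted ewd.
  by apply/allP=> x _; rewrite /= in_setT.
split.
  rewrite /words ewd /= size_rcons !in_setT /= andbT.
  by apply/allP=> x _; rewrite /= in_setT.
apply: (I_d (c :: e :: w)); last by rewrite /nostutter /= ce.
case/and3P: ew_word => ew_ns ew_G _.
by apply/and3P; split; rewrite // ?/nostutter /= ?ce // cG.
Qed.

Lemma strategy_common_sub (I J : perspective) (G : {set agent}) (d : agent) :
  (forall w, I w -> J w) -> strategy_common I G d -> strategy_common J G d.
Proof. by move=> IJ I_d w w_word wd; apply: IJ; apply: I_d. Qed.

Lemma strategy_common_agents (I : perspective) (G : {set agent}) (c d : agent) :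
  c \in G -> strategy_common I G d -> persp_agents I c d.
Proof.
move=> cG I_d; case: (eqVneq c d) => [->|cd]; [by right|left].
by apply: (I_d [:: c]); rewrite /words /nostutter /= ?cG ?cd.
Qed.

Lemma hprefix0 (Prp : countType) (GS : cgs Prp) (h : history GS) :
  hprefix h 0 = hist0 (hstart h).
Proof.
case: h => v s s_ok; rewrite /hprefix /hist0 /=.
(* The validity proof is generalised so that [take0] can rewrite in its type. *)
move: (steps_ok_take _ _) => /=; rewrite take0 => ok.
by congr History; apply: eq_irrelevance.
Qed.

Section Settled.

Variables (Prp : countType) (p q : Prp).

(** The invariant carried along accessibility chains; it records positions only, as [ag_b] cannot
    tell joint actions apart. *)
Definition settled (Z : state (G3 p q)) : Prop :=
  [/\ st_assign Z ag_a (hist0 (GS := G3 p q) v1) = alpha,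
      strategy_common (st_persp Z) [set ag_a; ag_b] ag_a,
      hstart (st_hist Z) = v1
    & unzip2 (hsteps (st_hist Z)) = [:: v2]].

Lemma settled_acc (Z Z' : state (G3 p q)) :
  st_accG [set ag_a; ag_b] Z Z' -> settled Z -> settled Z'.
Proof.
case: Z Z' => [chi I h] [chi' I' h'].
case=> c cG [/= chiE II' /andP[pos_sim _] _ h'_cons] [/= chi_v1 I_a h_v1 h_v2].
have I'_a : strategy_common I' [set ag_a; ag_b] ag_a.
  by apply: (@strategy_common_sub (persp_after I c)) => //;
     apply: strategy_common_after.
have chi'_v1 : chi' ag_a (hist0 (GS := G3 p q) v1) = alpha.
  by rewrite -chiE //; apply: strategy_common_agents cG I_a.
(* Consistency of the target state is relative to [I'], hence the need for [I'_a]. *)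
have h'_a i := h'_cons i ag_a (strategy_common_agents cG I'_a).
move: pos_sim; rewrite /hpositions h_v1 h_v2 /=.
case/andP=> start_sim steps_sim.
have h'_v1 : hstart h' = v1.
  (* For both agents, [v1] is alone in its class. *)
  by move: start_sim; case: (hstart h') (c) => [] [].
split=> //=.
case Eh': h' h'_v1 h'_a steps_sim => [v s s_ok] /= v_v1; subst v.
(* Only the length survives from [steps_sim]: for [ag_b], similarity to [v2] does not exclude
   [v3]. *)
case: s s_ok Eh' => [|[g v'] [|x s]] s_ok _ h'_a; rewrite /= ?andbF // => _.
have := h'_a ord0; rewrite /= hprefix0 chi'_v1 (tnth_nth g) /= => g_a.
by move: (s_ok) => /=; rewrite g_a andbT => /eqP <-.
Qed.

End Settled.

Theorem theorem2 (Prp : countType) (p q : Prp)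
    (chi : assignment (G3 p q)) (rho : history (G3 p q))
    (gamma1 : jaction (G3 p q)) (I : perspective)
    (chi_v1 : chi ag_a (hist0 (GS := G3 p q) v1) = alpha)
    (gamma1_a : gamma1 ag_a = alpha)
    (gamma1_b : gamma1 ag_b = chi ag_b (hist0 (GS := G3 p q) v1))
    (rho_start : hstart rho = v1)
    (rho_steps : hsteps rho = [:: (gamma1, v2 : V (G3 p q))])
    (I_common : strategy_common I [set ag_a; ag_b] ag_a) :
  forces (State chi I rho) (Common [set ag_a; ag_b] (Atom p)).
Proof.
move=> Z' acc.
have settled0 : settled (State chi I rho) by split; rewrite //= rho_steps.
suff [_ _ _ Z'_v2] : settled Z' by rewrite /= /hlast Z'_v2.
(* With [settled0] in the goal, the induction shows that every chain preserves [settled]. *)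
elim: acc settled0 => [Z1 Z2|Z1 Z2 Z3 _ IH12 _ IH23 /IH12/IH23 //].
exact: settled_acc.
Qed.
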